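(* Let $\tau>0$, $L\in\mathbb N$, $T=L\tau$ and $t_l=l\tau$ for $0\le l\le L$. Let $v^*:[0,T]\times\Omega\to\mathbb R$ be the value function of the finite horizon optimal control problem described in the context. Let $\hat v_0,\dots,\hat v_L:\Omega\to\mathbb R$ be functions with $\hat v_L=c_T$ and $\hat v_l\in\mathcal M$ for $0\le l\le L-1$. For $0\le l\le L-1$ let $\tilde v_l:\Omega\to\mathbb R$ be the solution (value function) of the local optimal control problem on $[t_l,t_{l+1}]$ with terminal condition $\hat v_{l+1}$, i.e. $$\tilde v_l(x)=\inf_{u\in L^2(t_l,t_{l+1};\mathbb R^m)}\Big[\int_{t_l}^{t_{l+1}}\ell(t,y(t),u(t))\,dt+\hat v_{l+1}(y(t_{l+1}))\Big],\qquad x\in\Omega,$$ where $y$ is the solution of $\dot y(t)=f(t,y(t))+g(t,y(t))u(t)$ on $[t_l,t_{l+1}]$ with $y(t_l)=x$. Let $\delta\ge 0$ and assume that $$|\tilde v_l(x)-\hat v_l(x)|\le\delta\qquad\text{for all }x\in\Omega\text{ and all }0\le l\le L-1.$$ Then $$\|\hat v_{L-l}(\cdot)-v^*(T-l\tau,\cdot)\|_{L^\infty(\Omega)}\le l\,\delta\qquad\text{for all }0\le l\le L.$$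
   Context: Setting. $\Omega\subset\mathbb R^d$ is the state domain, $T>0$ the time horizon. The functions $f:[0,T]\times\Omega\to\mathbb R^d$ and $g:[0,T]\times\Omega\to\mathbb R^{d\times m}$ are smooth (possibly nonlinear). The functions $c:[0,T]\times\Omega\to\mathbb R_{\ge0}$ and $c_T:\Omega\to\mathbb R_{\ge0}$ are non-negative, coercive and smooth. $R:[0,T]\to\mathbb R^{m\times m}$ is a family of positive definite matrices, continuous in time. The running cost is $\ell(t,x,u)=c(t,x)+u'R(t)u$ for $u\in\mathbb R^m$, where $u'$ denotes the transpose. Trajectories. For every initial time, initial value $x\in\Omega$ and every $L^2$ control $u$, the controlled ODE $\dot y(t)=f(t,y(t))+g(t,y(t))u(t)$ is assumed to have a trajectory $y$ on the time interval under consideration starting at $x$, with values in $\Omega$; this trajectory is determined by the initial time, the initial value and the control. Value function. For $(t_0,x)\in[0,T]\times\Omega$, $$v^*(t_0,x)=\inf_{u\in L^2(0,T;\mathbb R^m)}\Big[\int_{t_0}^T c(t,y(t))+u(t)'R(t)u(t)\,dt+c_T(y(T))\Big],$$ where $y$ solves the ODE on $[t_0,T]$ with control $u$ and $y(t_0)=x$. In particular $v^*(T,\cdot)=c_T$. Ansatz set. $\mathcal M\subset L^2(\Omega)$ is a chosen set of (everywhere defined, real-valued) ansatz functions on $\Omega$; the $\hat v_l\in\mathcal M$ are the computed approximations of $v^*(t_l,\cdot)$, obtained backwards in time by approximating $\tilde v_l$ within $\mathcal M$. *)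

(* Defs.v *)
From HB Require Import structures.
From mathcomp Require Import all_boot all_order all_algebra.
From mathcomp Require Import all_classical all_reals all_analysis.

Set Implicit Arguments.
Unset Strict Implicit.
Unset Printing Implicit Defensive.

Import Order.TTheory GRing.Theory Num.Theory.
Import numFieldNormedType.Exports.

Local Open Scope classical_set_scope.
Local Open Scope ring_scope.

(* R^n is the space 'cV[R]_n of column vectors.  Functions on [0, T], on Omega
   or on [0, T] x Omega are represented by total functions whose values outside
   that domain are irrelevant. *)

Section LebesgueMeasure.
Context (R : realType) (d : nat).

Definition box (a b : 'cV[R]_d.+1) : set 'cV[R]_d.+1 :=
  [set x | forall i, a i ord0 <= x i ord0 < b i ord0].

(* Meaningful when a <= b coordinatewise, which box_cover imposes. *)
Definition box_volume (ab : 'cV[R]_d.+1 * 'cV[R]_d.+1) : R :=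
  \prod_i (ab.2 i ord0 - ab.1 i ord0).

Definition box_cover (A : set 'cV[R]_d.+1)
    (F : nat -> 'cV[R]_d.+1 * 'cV[R]_d.+1) : Prop :=
  (forall k i, (F k).1 i ord0 <= (F k).2 i ord0) /\
  A `<=` \bigcup_k box (F k).1 (F k).2.

Definition lebesgue_outer (A : set 'cV[R]_d.+1) : \bar R :=
  ereal_inf [set (\sum_(0 <= k <oo) (box_volume (F k))%:E)%E |
             F in [set F | box_cover A F]].

Local Open Scope ereal_scope.

Lemma box_volume_ge0 A F k : box_cover A F -> 0 <= (box_volume (F k))%:E.
Proof.
by move=> [Fle _]; rewrite lee_fin; apply: prodr_ge0 => i _; rewrite subr_ge0.
Qed.

Lemma lebesgue_outer_ge0 A : 0 <= lebesgue_outer A.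
Proof.
apply: le_ereal_inf_tmp => _ [F AF <-]; apply: nneseries_ge0 => k _ _.
exact: (box_volume_ge0 k AF).
Qed.

Lemma lebesgue_outer0 : lebesgue_outer set0 = 0.
Proof.
apply/eqP; rewrite eq_le lebesgue_outer_ge0 andbT.
apply: ereal_inf_lbound; exists (fun=> (0, 0)%R); first by split.
apply: eseries0 => k _ _.
by rewrite /box_volume /= big_ord_recl !mxE subrr mul0r.
Qed.

Lemma le_lebesgue_outer : {homo lebesgue_outer : A B / A `<=` B >-> A <= B}.
Proof.
move=> A B AB; apply/ereal_inf_le_tmp => _ [F [Fle BF] <-].
by exists F => //; split => //; exact: subset_trans AB BF.
Qed.

Lemma lebesgue_outer_sigma_subadditive : sigma_subadditive lebesgue_outer.
Proof.
move=> A; have [[i ioo]|] := pselect (exists i, lebesgue_outer (A i) = +oo).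
  rewrite (eseries_pinfty _ _ ioo) ?leey// => n _.
  by rewrite -ltNye (lt_le_trans _ (lebesgue_outer_ge0 _)).
rewrite -forallNE => Aoo.
suff add2e (e : {posnum R}) : lebesgue_outer (\bigcup_n A n) <=
    \sum_(i <oo) lebesgue_outer (A i) + e%:num%:E.
  by apply/lee_addgt0Pr => _/posnumP[].
rewrite (le_trans _ (epsilon_trick _ _ _))//; last first.
  by move=> n; exact: lebesgue_outer_ge0.
pose P n F := box_cover (A n) F /\ \sum_(0 <= k <oo) (box_volume (F k))%:E
    <= lebesgue_outer (A n) + (e%:num / (2 ^ n.+1)%:R)%:E.
have [G PG] : {G & forall n, P n (G n)}.
  apply: (@choice _ _ P) => n; rewrite /P /lebesgue_outer.
  set S := (X in ereal_inf X); move infS : (ereal_inf S) => iS.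
  case: iS infS => [r Sr|Soo|Soo].
  - have en1 : (0 < e%:num / (2 ^ n.+1)%:R)%R by [].
    have /(lb_ereal_inf_adherent en1) : ereal_inf S \is a fin_num by rewrite Sr.
    move=> [x [F AF Fx] xS].
    by exists F; split => //; rewrite Fx -Sr; exact/ltW.
  - by have := Aoo n; rewrite /lebesgue_outer -/S Soo.
  - by have := lebesgue_outer_ge0 (A n); rewrite /lebesgue_outer -/S Soo.
pose w (p : nat * nat) : \bar R := (box_volume (G p.1 p.2))%:E.
have w_ge0 p : 0 <= w p by exact: (box_volume_ge0 p.2 (PG p.1).1).
apply: (@le_trans _ _ (\esum_(i in setT) w i)).
  apply: ereal_inf_lbound => /=.
  have /card_esym/ppcard_eqP[f] := card_nat2.
  exists (fun k => G (f k).1 (f k).2).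
    split => [k i|t [i _]]; first exact: (PG (f k).1).1.1.
    move=> /((PG i).1.2) [j _ tj]; exists (f^-1%FUN (i, j)) => //=.
    by rewrite invK ?inE.
  transitivity (\sum_(0 <= k <oo) w (f k)) => //.
  rewrite -(esum_pred_image w _ xpredT) ?[fun=> _]set_true//.
  by rewrite image_eq.
rewrite (_ : esum _ _ = \sum_(i <oo) \sum_(j <oo) w (i, j)); last first.
  pose J : nat -> set (nat * nat) := fun i => [set (i, j) | j in setT].
  rewrite (_ : setT = \bigcup_k J k); last first.
    by rewrite predeqE => -[a b]; split => // _; exists a => //; exists b.
  rewrite esum_bigcupT /=; last 2 first.
    - apply/trivIsetP => i j _ _ ij.
      rewrite predeqE => -[n m] /=; split => //= -[] [_] _ [<-{n} _].
      by move=> [m' _] [] /esym/eqP; rewrite (negbTE ij).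
    - by [].
  rewrite -(image_id [set: nat]) -fun_true esum_pred_image//; last first.
    by move=> n _; exact: esum_ge0.
  apply: eq_eseriesr => /= j _.
  rewrite -(esum_pred_image w (pair j) predT)//=; last first.
    by move=> ? ? _ _; exact: (@can_inj _ _ _ snd).
  by congr esum; rewrite predeqE => -[a b]; split; move=> [i _ <-]; exists i.
apply: lee_lim.
- by apply: is_cvg_nneseries => n *; apply: nneseries_ge0.
- by apply: is_cvg_nneseries => n *; apply: adde_ge0 => //;
    exact: lebesgue_outer_ge0.
- by near=> n; apply: lee_sum => i _; exact: (PG i).2.
Unshelve. all: by end_near. Qed.

HB.instance Definition _ := isOuterMeasure.Build R 'cV[R]_d.+1 lebesgue_outer
  lebesgue_outer0 lebesgue_outer_ge0 le_lebesgue_outer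
  lebesgue_outer_sigma_subadditive.

Let outer : {outer_measure set 'cV[R]_d.+1 -> \bar R} := lebesgue_outer.

(* 'cV[R]_d.+1 with its Lebesgue sigma-algebra. *)
Definition lebesgue_space : measurableType (caratheodory_display outer) :=
  caratheodory_type outer.

Definition lebesgue_cV : {measure set lebesgue_space -> \bar R} :=
  (outer : set (caratheodory_type outer) -> \bar R).

End LebesgueMeasure.

Section FunctionSpaces.
Context (R : realType) (d : nat).

Definition square_integrable {dsp : measure_display} {X : measurableType dsp}
    (mu : {measure set X -> \bar R}) (D : set X) (h : X -> R) : Prop :=
  measurable_fun D h /\ mu.-integrable D (fun x => (h x ^+ 2)%:E).

Definition L2_space (Omega : set (lebesgue_space R d)) :
    set ('cV[R]_d.+1 -> R) :=
  [set h | square_integrable (lebesgue_cV R d) Omega h].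

Definition Linfty_norm (Omega : set (lebesgue_space R d))
    (h : 'cV[R]_d.+1 -> \bar R) : \bar R :=
  Lnorm (lebesgue_cV R d) +oo%E (h \_ Omega).

Definition L2_control (m : nat) (a b : R) : set (R -> 'cV[R]_m) :=
  [set u | forall i : 'I_m,
    square_integrable lebesgue_measure `[a, b] (fun t => u t i ord0)].

End FunctionSpaces.

Section Smoothness.
Context (R : realType) (V W : normedModType R).

(* In finite dimension, continuity of all iterated directional derivatives of
   order at most k is the usual C^k condition. *)
Fixpoint Ck (k : nat) (U : set V) (F : V -> W) : Prop :=
  (forall x, U x -> {for x, continuous F}) /\
  if k is k'.+1 then
    forall v, (forall x, U x -> derivable F x v) /\ Ck k' U ('D_v F)
  else True.

(* Smoothness on a not necessarily open set, by local smooth extension. *)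
Definition smooth_on (S : set V) (F : V -> W) : Prop :=
  forall p, S p -> exists (U : set V) (G : V -> W),
    [/\ open U, U p, forall k, Ck k U G & forall q, U q -> S q -> F q = G q].

End Smoothness.

Section Coercivity.
Context (R : realType) (d : nat).

Definition coercive (Omega : set 'cV[R]_d.+1) (h : 'cV[R]_d.+1 -> R) : Prop :=
  forall M : R, exists r : R, forall x, Omega x -> r <= `|x| -> M <= h x.

End Coercivity.

(* Symmetry is not required: the quadratic form is all that matters. *)
Definition positive_definite (R : realType) (m : nat) (A : 'M[R]_m) : Prop :=
  forall u : 'cV[R]_m, u != 0 -> 0 < (u^T *m A *m u) ord0 ord0.

Section OptimalControl.
Context (R : realType) (d m : nat).
Context (Omega : set 'cV[R]_d.+1).
Context (f : R -> 'cV[R]_d.+1 -> 'cV[R]_d.+1).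
Context (g : R -> 'cV[R]_d.+1 -> 'M[R]_(d.+1, m)).

Definition velocity (t : R) (y : 'cV[R]_d.+1) (u : 'cV[R]_m) : 'cV[R]_d.+1 :=
  f t y + g t y *m u.

(* Caratheodory solution with values in Omega: for L^2 controls the equation
   y' = f(t,y) + g(t,y)u only makes sense almost everywhere, so it is stated in
   integrated form. *)
Definition trajectory (t0 t1 : R) (x : 'cV[R]_d.+1) (u : R -> 'cV[R]_m)
    (y : R -> 'cV[R]_d.+1) : Prop :=
  (forall t, t0 <= t <= t1 -> Omega (y t)) /\
  forall i : 'I_d.+1,
    lebesgue_measure.-integrable `[t0, t1]
      (fun s => (velocity s (y s) (u s) i ord0)%:E) /\
    forall t, t0 <= t <= t1 ->
      y t i ord0 = x i ord0 +
        \int[lebesgue_measure]_(s in `[t0, t]) velocity s (y s) (u s) i ord0.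

Definition well_posed (T : R) : Prop :=
  forall t0 t1, 0 <= t0 -> t0 <= t1 -> t1 <= T ->
  forall x, Omega x -> forall u, L2_control t0 t1 u ->
    (exists y, trajectory t0 t1 x u y) /\
    (forall y z, trajectory t0 t1 x u y -> trajectory t0 t1 x u z ->
       forall t, t0 <= t <= t1 -> y t = z t).

Context (c : R -> 'cV[R]_d.+1 -> R) (Q : R -> 'M[R]_m).

Definition running_cost (t : R) (y : 'cV[R]_d.+1) (u : 'cV[R]_m) : R :=
  c t y + (u^T *m Q t *m u) ord0 ord0.

Definition total_cost (t0 t1 : R) (phi : 'cV[R]_d.+1 -> R)
    (u : R -> 'cV[R]_m) (y : R -> 'cV[R]_d.+1) : \bar R :=
  (\int[lebesgue_measure]_(t in `[t0, t1]) (running_cost t (y t) (u t))%:E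
   + (phi (y t1))%:E)%E.

(* Infimum over the controls in U; under well_posed the trajectory y below is the
   one determined by t0, x and u. *)
Definition optimal_value (U : set (R -> 'cV[R]_m)) (t0 t1 : R)
    (phi : 'cV[R]_d.+1 -> R) (x : 'cV[R]_d.+1) : \bar R :=
  ereal_inf [set z | exists u y,
    [/\ U u, trajectory t0 t1 x u y & z = total_cost t0 t1 phi u y]].

Definition value_function (T : R) (cT : 'cV[R]_d.+1 -> R)
    (t0 : R) (x : 'cV[R]_d.+1) : \bar R :=
  optimal_value (@L2_control R m 0 T) t0 T cT x.

Definition local_value (t0 t1 : R) (phi : 'cV[R]_d.+1 -> R)
    (x : 'cV[R]_d.+1) : \bar R :=
  optimal_value (@L2_control R m t0 t1) t0 t1 phi x.

End OptimalControl.

(* Main.v *)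
Require Import Defs.
From mathcomp Require Import all_boot all_order all_algebra.
From mathcomp Require Import all_classical all_reals all_analysis.
From mathcomp Require Import ess_sup_inf measurable_realfun.
Import Order.TTheory GRing.Theory Num.Theory.
Import numFieldNormedType.Exports.
Local Open Scope classical_set_scope.
Local Open Scope ring_scope.

(** The estimate is an induction along the time grid, carried by two facts
    about the operator that maps a terminal cost phi at time b to the optimal
    cost at time a:

      B(a,b) phi (x) = inf over u of (running cost on [a, b] + phi (y b)).

    First, B is a semigroup on nonnegative terminal costs (Bellman's principle,
    [bellman_semigroup]): B(a,e) = B(a,b) o B(b,e).  Hence the value function
    satisfies V(t_k) = B(t_k, t_(k+1)) V(t_(k+1)), while the local problems
    are B(t_k, t_(k+1)) vhat_(k+1).  Second, B does not amplify errors in the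
    terminal cost ([bellman_le_shift]): it is monotone and commutes with the
    addition of constants, so it is 1-Lipschitz for the supremum distance.
    Going back by one time step therefore adds at most the approximation error
    delta of that step to the error made so far ([bellman_error_step]), and l
    steps produce at most l * delta.  Everything holds pointwise on Omega, so
    the bound on the essential supremum follows.

    The semigroup law is where the analysis lies.  Trajectories and controls
    may be restricted to a subinterval, and consecutive ones may be glued
    ([trajectory_splice]), because the state equation is an integral identity
    and integrals are additive over consecutive intervals.  The cost integrals
    may be infinite, so their additivity requires the running cost along a
    trajectory to be nonnegative and measurable
    ([measurable_running_cost]); the latter rests on the continuity of
    trajectories, as indefinite integrals, and on the continuity of c and Q. *)

Set Implicit Arguments.
Unset Strict Implicit.

(** * Integrals over consecutive intervals *)

Lemma integrable_setU {R : realType} {dsp : measure_display}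
    {X : measurableType dsp} (nu : {measure set X -> \bar R}) (A B : set X)
    (h : X -> \bar R) :
  measurable A -> measurable B -> [disjoint A & B] ->
  nu.-integrable A h -> nu.-integrable B h -> nu.-integrable (A `|` B) h.
Proof.
move=> mA mB AB /integrableP[mhA iA] /integrableP[mhB iB].
have mh : measurable_fun (A `|` B) h by exact/(measurable_funU _ mA mB).
apply/integrableP; split => //.
rewrite ge0_integral_setU//; last exact: measurableT_comp.
exact: lte_add_pinfty.
Qed.

Section ConsecutiveIntervals.
Context {R : realType}.
Notation mu := (@lebesgue_measure R).

Lemma itv_cc_split (a b t : R) : a <= b -> b <= t ->
  `[a, t]%classic = `[a, b[%classic `|` `[b, t]%classic.
Proof. by move=> ab bt; apply: itv_bndbnd_setU; rewrite bnd_simp. Qed.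

Lemma disjoint_itv_co_cc (a b t : R) :
  [disjoint `[a, b[%classic & `[b, t]%classic].
Proof.
apply/disj_setPS => s /= []; rewrite !in_itv /= => /andP[_ sb] /andP[bs _].
by have := lt_le_trans sb bs; rewrite ltxx.
Qed.

Lemma ge0_integral_itv_split (a b t : R) (h : R -> \bar R) :
  a <= b -> b <= t -> measurable_fun `[a, t] h ->
  (forall s, `[a, t]%classic s -> 0 <= h s)%E ->
  (\int[mu]_(s in `[a, t]) h s =
   \int[mu]_(s in `[a, b[) h s + \int[mu]_(s in `[b, t]) h s)%E.
Proof.
move=> ab bt; rewrite (itv_cc_split ab bt) => mh h0.
by rewrite ge0_integral_setU//; exact: disjoint_itv_co_cc.
Qed.

Lemma Rintegral_itv_split (a b t : R) (h : R -> R) :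
  a <= b -> b <= t -> mu.-integrable `[a, t] (EFin \o h) ->
  \int[mu]_(s in `[a, t]) h s =
  \int[mu]_(s in `[a, b[) h s + \int[mu]_(s in `[b, t]) h s.
Proof.
move=> ab bt; rewrite (itv_cc_split ab bt) => ih.
by rewrite Rintegral_setU//; exact: disjoint_itv_co_cc.
Qed.

End ConsecutiveIntervals.

(** * Continuity relative to a set *)

Lemma within_comp {U V W : topologicalType} (A : set U) (S : set V)
    (p : U -> V) (F : V -> W) :
  {within A, continuous p} -> {within S, continuous F} ->
  (forall s, A s -> S (p s)) -> {within A, continuous (F \o p)}.
Proof.
move=> /subspace_continuousP pc /subspace_continuousP Fc AS.
apply/subspace_continuousP => s As B nB.
have /(pc _ As) := Fc _ (AS _ As) B nB.
rewrite /nbhs/= /within/=; apply: filterS => r + Ar; apply => //.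
exact: AS.
Qed.

Lemma within_pair {U V W : topologicalType} (A : set U) (p : U -> V)
    (q : U -> W) :
  {within A, continuous p} -> {within A, continuous q} ->
  {within A, continuous (fun s => (p s, q s))}.
Proof.
move=> /subspace_continuousP pc /subspace_continuousP qc.
apply/subspace_continuousP => s As.
by apply: cvg_pair; [exact: pc|exact: qc].
Qed.

Lemma smooth_on_continuous {R : realType} {V W : normedModType R} (S : set V)
    (F : V -> W) :
  smooth_on S F -> {within S, continuous F}.
Proof.
move=> sF; apply/subspace_continuousP => p Sp.
have [U [G [oU Up /(_ 0%N) [Gc _] FG]]] := sF _ Sp.
suff : F x @[x --> within S (nbhs p)] --> G p by rewrite -(FG _ Up Sp).
have GG : G x @[x --> within S (nbhs p)] --> G p.
  by apply: cvg_within_filter; exact: Gc.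
apply: cvg_trans GG; apply: near_eq_cvg.
rewrite near_withinE; near=> q => Sq; apply/esym/FG => //.
by near: q; exact: open_nbhs_nbhs.
Unshelve. all: by end_near. Qed.

Lemma continuous_within_col {R : realType} (n : nat) (A : set R)
    (y : R -> 'cV[R]_n) :
  (forall i, {within A, continuous (fun t => y t i ord0)}) ->
  {within A, continuous y}.
Proof.
move=> yc; apply/subspace_continuousP => t At; apply/cvg_ballP => e e0.
have : \forall s \near within A (nbhs t),
    forall i, ball (y t i ord0) e (y s i ord0).
  apply: filter_forall => i.
  have /subspace_continuousP/(_ t At)/cvg_ballP := yc i.
  exact.
by apply: filterS => s ys; split => // i j; rewrite (ord1 j).
Qed.

(** * Restricting and gluing controls *)

Section Controls.
Context {R : realType} {m : nat}.
Implicit Types u v : R -> 'cV[R]_m.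

(** The switching instant belongs to the second path, which thus is unchanged
    on its whole closed interval [b, c].  Only the first one loses an endpoint,
    a null set; a state path does not even lose its value there when the second
    path starts where the first one ends. *)
Definition splice {X : Type} (b : R) (p q : R -> X) (t : R) : X :=
  if t < b then p t else q t.

Lemma spliceL {X : Type} (a b : R) (p q : R -> X) :
  {in `[a, b[%classic, p =1 splice b p q}.
Proof. by move=> t /set_mem/=; rewrite in_itv/= /splice => /andP[_ ->]. Qed.

Lemma spliceR {X : Type} (b c : R) (p q : R -> X) :
  {in `[b, c]%classic, q =1 splice b p q}.
Proof.
move=> t /set_mem/=; rewrite in_itv/= /splice => /andP[bt _].
by rewrite ltNge bt.
Qed.

Lemma square_integrable_itvS (i j : interval R) (h : R -> R) :
  [set` j] `<=` [set` i] ->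
  square_integrable lebesgue_measure [set` i] h ->
  square_integrable lebesgue_measure [set` j] h.
Proof.
move=> sub [mh ih]; split; first exact: (measurable_funS _ sub mh).
exact: integrableS ih.
Qed.

Lemma square_integrable_splice (a b c : R) (h k : R -> R) :
  a <= b -> b <= c ->
  square_integrable lebesgue_measure `[a, b] h ->
  square_integrable lebesgue_measure `[b, c] k ->
  square_integrable lebesgue_measure `[a, c] (splice b h k).
Proof.
move=> ab bc sh [mk ik].
have [mh ih] : square_integrable lebesgue_measure `[a, b[ h.
  by apply: square_integrable_itvS sh; exact: subset_itv_co_cc.
rewrite (itv_cc_split ab bc); split.
  apply/(measurable_funU _ _ _) => //; split.
    exact: eq_measurable_fun (spliceL h k) mh.
  exact: eq_measurable_fun (spliceR h k) mk.
apply: integrable_setU => //; first exact: disjoint_itv_co_cc.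
  by apply: eq_integrable ih => // t tab; rewrite -(spliceL h k tab).
by apply: eq_integrable ik => // t tbc; rewrite -(spliceR h k tbc).
Qed.

Lemma L2_control_sub (a b a' b' : R) u :
  a <= a' -> b' <= b -> L2_control a b u -> L2_control a' b' u.
Proof.
move=> aa bb Lu i; apply: square_integrable_itvS (Lu i).
by apply: subset_itv; rewrite bnd_simp.
Qed.

Lemma L2_control_splice (a b c : R) u v :
  a <= b -> b <= c -> L2_control a b u -> L2_control b c v ->
  L2_control a c (splice b u v).
Proof.
move=> ab bc Lu Lv i.
rewrite (_ : (fun t => _) =
    splice b (fun t => u t i ord0) (fun t => v t i ord0)).
  exact: square_integrable_splice.
by apply/funext => t; rewrite /splice; case: ifP.
Qed.

Lemma L2_control0 (a b : R) : L2_control a b (fun=> (0 : 'cV[R]_m)).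
Proof.
move=> i; rewrite (_ : (fun t => _) = cst 0); last first.
  by apply/funext => t; rewrite mxE.
split; first exact: measurable_cst.
rewrite (_ : (fun t => _) = cst 0%E); first exact: integrable0.
by apply/funext => t; rewrite expr0n.
Qed.

End Controls.

(** * Restricting and gluing trajectories *)

Section Trajectories.
Context {R : realType} {d m : nat} {Omega : set 'cV[R]_d.+1}.
Context {f : R -> 'cV[R]_d.+1 -> 'cV[R]_d.+1}.
Context {g : R -> 'cV[R]_d.+1 -> 'M[R]_(d.+1, m)}.
Implicit Types (u v : R -> 'cV[R]_m) (x : 'cV[R]_d.+1).
Implicit Types (y z : R -> 'cV[R]_d.+1).
Notation traj := (trajectory Omega f g).
Notation mu := (@lebesgue_measure R).
Notation vel u y i := (fun s => velocity f g s (y s) (u s) i ord0).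

Lemma trajectory_start a b x u y : a <= b -> traj a b x u y -> y a = x.
Proof.
move=> ab [_ ty]; apply/matrixP => i j; rewrite (ord1 j).
have [_ /(_ a)] := ty i; rewrite lexx ab => /(_ isT) ->.
by rewrite set_itv1 Rintegral_set1 addr0.
Qed.

Lemma trajectory_continuous a b x u y : a <= b -> traj a b x u y ->
  {within `[a, b], continuous y}.
Proof.
move=> ab [_ ty]; apply: continuous_within_col => i.
have [iv yE] := ty i.
apply: (@subspace_eq_continuous _ _ _
   (fun t => x i ord0 + \int[mu]_(s in `[a, t]) vel u y i s)).
  by move=> t /set_mem/=; rewrite in_itv/= => /yE /esym.
have /subspace_continuousP pc :=
  @parameterized_integral_continuous R a b (vel u y i) ab iv.
apply/subspace_continuousP => t At; apply: cvgD; first exact: cvg_cst.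
exact: pc.
Qed.

Lemma trajectory_left a b c x u y : a <= b -> b <= c ->
  traj a c x u y -> traj a b x u y.
Proof.
move=> ab bc [Oy ty]; split => [t /andP[at_ tb]|i].
  by apply: Oy; rewrite at_ (le_trans tb bc).
have [iv yE] := ty i; split.
  by apply: integrableS iv => //; apply: subset_itvl; rewrite bnd_simp.
by move=> t /andP[at_ tb]; apply: yE; rewrite at_ (le_trans tb bc).
Qed.

Lemma trajectory_right a b c x u y : a <= b -> b <= c ->
  traj a c x u y -> traj b c (y b) u y.
Proof.
move=> ab bc [Oy ty]; split => [t /andP[bt tc]|i].
  by apply: Oy; rewrite tc (le_trans ab bt).
have [iv yE] := ty i; split.
  by apply: integrableS iv => //; apply: subset_itvr; rewrite bnd_simp.
move=> t /andP[bt tc]; rewrite !yE ?ab ?bc ?tc ?(le_trans ab bt)//.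
have ivt : mu.-integrable `[a, t] (EFin \o vel u y i).
  by apply: integrableS iv => //; apply: subset_itvl; rewrite bnd_simp.
rewrite (Rintegral_itv_split ab bt ivt) addrA Rintegral_itv_bndo_bndc//.
by apply: integrableS ivt => //; apply: subset_itvl; rewrite bnd_simp.
Qed.

Lemma trajectory_eq a b x u v y : {in `[a, b]%classic, u =1 v} ->
  traj a b x u y -> traj a b x v y.
Proof.
move=> uv [Oy ty]; split => // i; have [iv yE] := ty i.
have E : {in `[a, b]%classic, vel u y i =1 vel v y i}.
  by move=> s sab; rewrite (uv s sab).
split; first by apply: eq_integrable iv => // s sab /=; rewrite (E s sab).
move=> t /[dup] /andP[_ tb] /yE ->; congr (_ + _).
apply: eq_Rintegral => s sat; apply: E.
by move: s sat; apply/subsetP/subset_itvl; rewrite bnd_simp.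
Qed.

Lemma trajectory_splice a b c x u v y z : a <= b -> b <= c ->
  traj a b x u y -> traj b c (y b) v z ->
  traj a c x (splice b u v) (splice b y z).
Proof.
move=> ab bc ty tz.
case: ty => Oy ty; case: tz => Oz tz; split => [t /andP[at_ tc]|i].
  rewrite /splice; case: ltP => [tb|bt]; first by apply: Oy; rewrite at_ ltW.
  by apply: Oz; rewrite bt.
have [ivy yE] := ty i; have [ivz zE] := tz i.
set w := vel _ _ _.
have wy : {in `[a, b[%classic, vel u y i =1 w}.
  by move=> s sab; rewrite /w -!(spliceL _ _ sab).
have wz : {in `[b, c]%classic, vel v z i =1 w}.
  by move=> s sbc; rewrite /w -!(spliceR _ _ sbc).
have ivyo : mu.-integrable `[a, b[ (EFin \o vel u y i).
  by apply: integrableS ivy => //; exact: subset_itv_co_cc.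
have iw : mu.-integrable `[a, c] (EFin \o w).
  rewrite (itv_cc_split ab bc); apply: integrable_setU => //.
  - exact: disjoint_itv_co_cc.
  - by apply: eq_integrable ivyo => // s sab /=; rewrite wy.
  - by apply: eq_integrable ivz => // s sbc /=; rewrite wz.
split=> // t /andP[at_ tc]; rewrite {1}/splice; case: ltP => [tb|bt].
  rewrite yE ?at_ ?ltW//; congr (_ + _); apply: eq_Rintegral => s sat.
  by apply: wy; move: s sat; apply/subsetP/subset_itvl; rewrite bnd_simp.
(* x + int_[a,t] = (x + int_[a,b]) + int_[b,t], and the bracket is y b. *)
rewrite zE ?bt// yE ?ab ?lexx// -addrA; congr (_ + _).
rewrite -Rintegral_itv_bndo_bndc// (Rintegral_itv_split ab bt); last first.
  by apply: integrableS iw => //; apply: subset_itvl; rewrite bnd_simp.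
congr (_ + _); apply: eq_Rintegral => s sat; first exact: wy.
by apply: wz; move: s sat; apply/subsetP/subset_itvl; rewrite bnd_simp.
Qed.

End Trajectories.

(** * The Bellman operator *)

Lemma abse_sub_fin_le {R : realType} (v : \bar R) (r e : R) :
  (`|v - r%:E| <= e%:E)%E <-> (v <= r%:E + e%:E)%E /\ (r%:E <= v + e%:E)%E.
Proof.
case: v => [s| |] /=; [|by split=> [//|[]]..].
by rewrite !lee_fin ler_distl lerBlDr; split=> [/andP[-> ->]|[-> ->]].
Qed.

Section Bellman.
Context {R : realType} {d m : nat}.
Context (Omega : set 'cV[R]_d.+1).
Context (f : R -> 'cV[R]_d.+1 -> 'cV[R]_d.+1).
Context (g : R -> 'cV[R]_d.+1 -> 'M[R]_(d.+1, m)).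
Context (c : R -> 'cV[R]_d.+1 -> R) (Q : R -> 'M[R]_m).
Implicit Types (phi psi : 'cV[R]_d.+1 -> \bar R) (x : 'cV[R]_d.+1).
Implicit Types (u v : R -> 'cV[R]_m) (y : R -> 'cV[R]_d.+1) (a b : R).
Notation traj := (trajectory Omega f g).
Notation mu := (@lebesgue_measure R).
Notation cost u y := (fun t => running_cost c Q t (y t) (u t)).

Definition stage_cost (a b : R) u y : \bar R :=
  (\int[mu]_(t in `[a, b]) (cost u y t)%:E)%E.

(** Terminal costs are extended real so that a value function, which may be
    infinite, can serve as the terminal cost of an earlier interval. *)
Definition bellman (a b : R) phi x : \bar R :=
  ereal_inf [set r | exists u y, [/\ L2_control a b u, traj a b x u y &
    r = (stage_cost a b u y + phi (y b))%E]].

Lemma local_value_bellman a b (h : 'cV[R]_d.+1 -> R) x :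
  local_value Omega f g c Q a b h x = bellman a b (EFin \o h) x.
Proof. by []. Qed.

(** Controls on [0, T] and on [a, T] yield the same costs from time a on: the
    former restrict to the latter, and conversely extend by zero. *)
Lemma value_function_bellman T cT a x : 0 <= a -> a <= T ->
  value_function Omega f g c Q T cT a x = bellman a T (EFin \o cT) x.
Proof.
move=> a0 aT; congr ereal_inf; apply/seteqP; split => r [u [y [Lu ty ->]]].
  by exists u, y; split => //; exact: L2_control_sub Lu.
exists (splice a (fun=> 0) u), y.
have uE : {in `[a, T]%classic, u =1 splice a (fun=> 0) u} by exact: spliceR.
split; first by apply: L2_control_splice => //; exact: L2_control0.
- exact: trajectory_eq uE ty.
- by congr (_ + _)%E; apply: eq_integral => t taT; rewrite -uE.
Qed.

Lemma bellman_point b phi x :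
  (exists u y, L2_control b b u /\ traj b b x u y) ->
  bellman b b phi x = phi x.
Proof.
move=> [u [y [Lu ty]]].
have cost0 v z : stage_cost b b v z = 0%E.
  by rewrite /stage_cost set_itv1 integral_set1.
apply/eqP; rewrite eq_le; apply/andP; split.
  apply: ereal_inf_lbound; exists u, y; split => //.
  by rewrite cost0 add0e (trajectory_start (lexx b) ty).
apply: le_ereal_inf_tmp => _ [v [z [_ tz ->]]].
by rewrite cost0 add0e (trajectory_start (lexx b) tz).
Qed.

(** Monotonicity and equivariance under constants in one inequality: an error e
    in the terminal cost shifts the cost of every control by at most e, hence
    the infimum too. *)
Lemma bellman_le_shift a b phi psi (e : R) x : a <= b ->
  (forall z, Omega z -> phi z <= psi z + e%:E)%E ->
  (bellman a b phi x <= bellman a b psi x + e%:E)%E.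
Proof.
move=> ab phipsi; rewrite -leeBlDr//.
apply: le_ereal_inf_tmp => _ [u [y [Lu ty ->]]]; rewrite leeBlDr// -addeA.
apply: (@le_trans _ _ (stage_cost a b u y + phi (y b))%E).
  by apply: ereal_inf_lbound; exists u, y.
by apply: leeD => //; apply: phipsi; apply: ty.1; rewrite ab lexx.
Qed.

(** One step of the backward recursion: the error e of the terminal cost is
    propagated without amplification, and the error del of approximating the
    local value at x is added to it. *)
Lemma bellman_error_step a b phi (h : 'cV[R]_d.+1 -> R) (e r del : R) x :
  a <= b ->
  (forall z, Omega z -> `|phi z - (h z)%:E| <= e%:E)%E ->
  (`|bellman a b (EFin \o h) x - r%:E| <= del%:E)%E ->
  (`|bellman a b phi x - r%:E| <= (e + del)%:E)%E.
Proof.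
move=> ab phih /abse_sub_fin_le[Br rB]; apply/abse_sub_fin_le.
rewrite (addrC e) EFinD !addeA; split.
  apply: le_trans (leeD2r _ Br); apply: bellman_le_shift => // z Oz.
  by have /abse_sub_fin_le[] := phih z Oz.
apply: (le_trans rB); rewrite addeAC leeD2r//.
apply: bellman_le_shift => // z Oz.
by have /abse_sub_fin_le[] := phih z Oz.
Qed.

(** * Bellman's principle of optimality *)

Section Principle.
Context (T : R).
Context (c_smooth : smooth_on (`[0, T] `*` Omega)
   (fun p : R * 'cV[R]_d.+1 => c p.1 p.2)).
Context (c_ge0 : forall t x, 0 <= t <= T -> Omega x -> 0 <= c t x).
Context (Q_posdef : forall t, 0 <= t <= T -> positive_definite (Q t)).
Context (Q_cont : {within `[0, T], continuous Q}).

Lemma running_cost_ge0 t x (w : 'cV[R]_m) : 0 <= t <= T -> Omega x ->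
  0 <= running_cost c Q t x w.
Proof.
move=> tT Ox; apply: addr_ge0; first exact: c_ge0.
have [->|w0] := eqVneq w 0; first by rewrite mulmx0 mxE.
exact/ltW/Q_posdef.
Qed.

(** The state part t |-> c t (y t) is continuous; the control part is a
    polynomial in the measurable coordinates of u, with coefficients the
    continuous entries of Q. *)
Lemma measurable_running_cost a b x u y : 0 <= a -> a <= b -> b <= T ->
  L2_control a b u -> traj a b x u y -> measurable_fun `[a, b] (cost u y).
Proof.
move=> a0 ab bT Lu ty.
have sub : `[a, b]%classic `<=` `[0, T]%classic.
  by apply: subset_itv; rewrite bnd_simp.
have idc : {within `[a, b], continuous (@idfun R)}.
  by apply: continuous_subspaceT => t; exact: cvg_id.
have yc := trajectory_continuous ab ty.
apply: measurable_funD.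
  apply: subspace_continuous_measurable_fun => //.
  apply: (within_comp (within_pair idc yc) (smooth_on_continuous c_smooth)).
  by move=> s sab; split => /=; [exact: sub|exact: ty.1].
rewrite (_ : (fun t => _) = fun t =>
    \sum_j (\sum_k u t k ord0 * Q t k j) * u t j ord0); last first.
  apply/funext => t; rewrite mxE; apply: eq_bigr => j _; congr (_ * _).
  by rewrite mxE; apply: eq_bigr => k _; rewrite mxE.
apply: measurable_sum => j; apply: measurable_funM; last exact: (Lu j).1.
apply: measurable_sum => k; apply: measurable_funM; first exact: (Lu k).1.
apply: (measurable_funS _ sub) => //.
apply: subspace_continuous_measurable_fun => //.
apply/subspace_continuousP => t tT.
have /subspace_continuousP/(_ t tT) Qt := Q_cont.
exact: (cvg_comp Q (fun A : 'M[R]_m => A k j) Qt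
  (@coord_continuous R m m k j (Q t))).
Qed.

Lemma stage_cost_ge0 a b x u y : 0 <= a -> b <= T -> traj a b x u y ->
  (0 <= stage_cost a b u y)%E.
Proof.
move=> a0 bT ty; apply: integral_ge0 => t /=; rewrite in_itv/= => /andP[at_ tb].
rewrite lee_fin; apply: running_cost_ge0.
  by rewrite (le_trans a0 at_) (le_trans tb bT).
by apply: ty.1; rewrite at_.
Qed.

Lemma stage_cost_co a b x u y : 0 <= a -> a <= b -> b <= T ->
  L2_control a b u -> traj a b x u y ->
  stage_cost a b u y = (\int[mu]_(t in `[a, b[) (cost u y t)%:E)%E.
Proof.
move=> a0 ab bT Lu ty; apply/esym/integral_itv_bndo_bndc/measurable_EFinP.
apply: measurable_funS (measurable_running_cost a0 ab bT Lu ty) => //.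
exact: subset_itv_co_cc.
Qed.

Lemma stage_cost_split a b e x u y : 0 <= a -> a <= b -> b <= e -> e <= T ->
  L2_control a e u -> traj a e x u y ->
  (stage_cost a e u y = stage_cost a b u y + stage_cost b e u y)%E.
Proof.
move=> a0 ab be eT Lu ty.
have mc := measurable_running_cost a0 (le_trans ab be) eT Lu ty.
rewrite (stage_cost_co a0 ab (le_trans be eT) (L2_control_sub (lexx a) be Lu)
  (trajectory_left ab be ty)) /stage_cost (ge0_integral_itv_split ab be)//.
  exact/measurable_EFinP.
move=> t /=; rewrite in_itv/= => /andP[at_ te]; rewrite lee_fin.
apply: running_cost_ge0; first by rewrite (le_trans a0 at_) (le_trans te eT).
by apply: ty.1; rewrite at_.
Qed.

Lemma stage_cost_splice a b e x u v y z :
  0 <= a -> a <= b -> b <= e -> e <= T ->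
  L2_control a b u -> traj a b x u y ->
  L2_control b e v -> traj b e (y b) v z ->
  (stage_cost a e (splice b u v) (splice b y z) =
   stage_cost a b u y + stage_cost b e v z)%E.
Proof.
move=> a0 ab be eT Lu ty Lv tz.
have Lw := L2_control_splice ab be Lu Lv.
have tw := trajectory_splice ab be ty tz.
have bT := le_trans be eT.
rewrite (stage_cost_split a0 ab be eT Lw tw) (stage_cost_co a0 ab bT Lu ty).
rewrite (stage_cost_co a0 ab bT (L2_control_sub (lexx a) be Lw)
  (trajectory_left ab be tw)).
congr (_ + _)%E; apply: eq_integral => t tI.
  by rewrite -!(spliceL _ _ tI).
by rewrite -!(spliceR _ _ tI).
Qed.

Lemma bellman_ge0 a b phi x : 0 <= a -> a <= b -> b <= T ->
  (forall z, Omega z -> 0 <= phi z)%E -> (0 <= bellman a b phi x)%E.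
Proof.
move=> a0 ab bT phi0; apply: le_ereal_inf_tmp => _ [u [y [Lu ty ->]]].
rewrite adde_ge0//; first exact: stage_cost_ge0 ty.
by apply: phi0; apply: ty.1; rewrite ab lexx.
Qed.

(** Any control on [a, e] splits at b into two controls of the same total cost,
    and any two consecutive controls can be glued, again without changing the
    total cost: minimizing over the whole interval amounts to minimizing over
    the second part first.  Nonnegativity of phi keeps the inner infimum away
    from -oo, which matters if the first part has infinite cost, where the
    convention +oo + -oo = -oo would break the equality. *)
Lemma bellman_semigroup a b e phi x : 0 <= a -> a <= b -> b <= e -> e <= T ->
  (forall z, Omega z -> 0 <= phi z)%E ->
  bellman a e phi x = bellman a b (bellman b e phi) x.
Proof.
move=> a0 ab be eT phi0; have b0 := le_trans a0 ab.
apply/eqP; rewrite eq_le; apply/andP; split.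
  apply: le_ereal_inf_tmp => _ [u [y [Lu ty ->]]].
  have := stage_cost_ge0 a0 (le_trans be eT) ty.
  case E : (stage_cost a b u y) => [r| |]// _; last first.
    have B0 := bellman_ge0 (y b) b0 be eT phi0.
    by rewrite addye ?leey// gt_eqF// (lt_le_trans _ B0).
  rewrite -leeBlDl//; apply: le_ereal_inf_tmp => _ [v [z [Lv tz ->]]].
  rewrite leeBlDl// addeA; apply: ereal_inf_lbound.
  exists (splice b u v), (splice b y z); split.
  - exact: L2_control_splice.
  - exact: trajectory_splice.
  - rewrite -E (stage_cost_splice (x := x))//; congr (_ + phi _)%E.
    by rewrite /splice ltNge be.
apply: le_ereal_inf_tmp => _ [u [y [Lu ty ->]]].
rewrite (stage_cost_split a0 ab be eT Lu ty) -addeA.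
apply: (@le_trans _ _ (stage_cost a b u y + bellman b e phi (y b))%E).
  apply: ereal_inf_lbound; exists u, y; split => //.
    exact: L2_control_sub Lu.
  exact: trajectory_left ty.
apply: leeD => //; apply: ereal_inf_lbound; exists u, y; split => //.
  exact: L2_control_sub Lu.
exact: trajectory_right ty.
Qed.

End Principle.
End Bellman.

Unset Implicit Arguments.
Set Strict Implicit.

(** * Backward accumulation of the error *)

Theorem theorem6 (R : realType) (d m : nat)
  (Omega : set 'cV[R]_d.+1)
  (Omega_meas : measurable (Omega : set (lebesgue_space R d)))
  (tau : R) (tau_gt0 : 0 < tau) (L : nat) (T : R) (T_def : T = L%:R * tau)
  (f : R -> 'cV[R]_d.+1 -> 'cV[R]_d.+1)
  (g : R -> 'cV[R]_d.+1 -> 'M[R]_(d.+1, m))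
  (c : R -> 'cV[R]_d.+1 -> R) (cT : 'cV[R]_d.+1 -> R) (Q : R -> 'M[R]_m)
  (f_smooth : smooth_on (`[0, T] `*` Omega)
     (fun p : R * 'cV[R]_d.+1 => f p.1 p.2))
  (g_smooth : smooth_on (`[0, T] `*` Omega)
     (fun p : R * 'cV[R]_d.+1 => g p.1 p.2))
  (c_smooth : smooth_on (`[0, T] `*` Omega)
     (fun p : R * 'cV[R]_d.+1 => c p.1 p.2))
  (c_ge0 : forall t x, 0 <= t <= T -> Omega x -> 0 <= c t x)
  (c_coercive : forall t, 0 <= t <= T -> coercive Omega (c t))
  (cT_smooth : smooth_on Omega cT)
  (cT_ge0 : forall x, Omega x -> 0 <= cT x)
  (cT_coercive : coercive Omega cT)
  (Q_posdef : forall t, 0 <= t <= T -> positive_definite (Q t))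
  (Q_cont : {within `[0, T], continuous Q})
  (ode_well_posed : well_posed Omega f g T)
  (M : set ('cV[R]_d.+1 -> R)) (M_L2 : M `<=` L2_space Omega)
  (vhat : nat -> 'cV[R]_d.+1 -> R)
  (vhat_L : forall x, Omega x -> vhat L x = cT x)
  (vhat_M : forall l : nat, (l < L)%N -> M (vhat l))
  (delta : R) (delta_ge0 : 0 <= delta)
  (vhat_err : forall l : nat, (l < L)%N -> forall x, Omega x ->
     (`| local_value Omega f g c Q (l%:R * tau) (l.+1%:R * tau) (vhat l.+1) x
         - (vhat l x)%:E | <= delta%:E)%E) :
  forall l : nat, (l <= L)%N ->
    (Linfty_norm Omega
       (fun x => (vhat (L - l)%N x)%:E
                 - value_function Omega f g c Q T cT (T - l%:R * tau) x)
     <= (l%:R * delta)%:E)%E.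
Proof.
have T0 : 0 <= T by rewrite T_def mulr_ge0// ltW.
have node k : (k <= L)%N -> 0 <= k%:R * tau <= T.
  by move=> kL; rewrite T_def ler_pM2r// ler_nat kL andbT mulr_ge0// ltW.
pose V t := bellman Omega f g c Q t T (EFin \o cT).
have key l : (l <= L)%N -> forall x, Omega x ->
    (`|V ((L - l)%:R * tau)%R x - (vhat (L - l)%N x)%:E|
     <= (l%:R * delta)%:E)%E.
  elim: l => [_|l IH lL] x Ox.
    rewrite subn0 -T_def vhat_L// /V bellman_point.
      by rewrite /= subrr normr0 mul0r.
    have [[y ty] _] := ode_well_posed T T T0 (lexx T) (lexx T) x Ox (fun=> 0)
      (L2_control0 _ _).
    by exists (fun=> 0), y; split => //; exact: L2_control0.
  have kL : (L - l.+1 < L)%N by rewrite ltn_subrL (leq_trans _ lL).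
  have kS : (L - l)%N = (L - l.+1).+1 by rewrite subnSK.
  move: (L - l.+1)%N kL kS => k kL kS; rewrite kS in IH.
  have /andP[k0 _] := node _ (ltnW kL).
  have /andP[_ kT] := node _ kL.
  have kk : k%:R * tau <= k.+1%:R * tau by rewrite ler_pM2r// ler_nat.
  have DPP := bellman_semigroup f g c_smooth c_ge0 Q_posdef Q_cont.
  rewrite -natr1 mulrDl mul1r /V (DPP _ _ _ _ _ k0 kk kT)//.
  exact: bellman_error_step kk (IH (ltnW lL)) (vhat_err _ kL _ Ox).
move=> l lL; rewrite /Linfty_norm unlock; case: ifPn => _; last first.
  by rewrite lee_fin mulr_ge0.
apply/ess_supP; apply: aeW => x /=; rewrite patchE; case: ifPn => [xO|_].
  have tE : T - l%:R * tau = (L - l)%:R * tau by rewrite T_def natrB// mulrBl.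
  have /andP[a0 aT] := node _ (leq_subr l L).
  rewrite tE value_function_bellman//.
  by have := key _ lL _ (set_mem xO); rewrite -abseN fin_num_oppeB// addeC.
by rewrite abse0 lee_fin mulr_ge0.
Qed.
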